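(* Let $N\ge2$, $d=\pi(N)$, let $p_1<\dots<p_d$ be the primes up to $N$, and for $n=\prod_{j=1}^dp_j^{\kappa_j}\le N$ write $z(n)=\prod_{j=1}^dz_j^{\kappa_j}$ for $z=(z_1,\dots,z_d)\in\mathbb{T}^d$. Let $F(z)=\sum_{n=1}^Na_nz(n)$ with complex coefficients $a_n$, let $\|F\|_{L^\infty(\mathbb{T}^d)}=\sup_{z\in\mathbb{T}^d}|F(z)|$, and for $0<\lambda<1$ set \[X_\lambda=\{z\in\mathbb{T}^d:|F(z)|\ge\lambda\|F\|_{L^\infty(\mathbb{T}^d)}\}.\] Then \[\mu_d(X_\lambda)\ge\Big(\frac{1-\lambda}{\pi^2}\Big)^{\pi(N)}e^{-\sqrt N}.\]
   Context: $\mathbb{T}^d=\{(z_1,\dots,z_d):|z_j|=1\}$ is the polytorus and $\mu_d$ is the normalized product Lebesgue (Haar) measure on it; $\pi(N)$ is the number of primes $\le N$. *)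

(* Defs.v *)
From HB Require Import structures.
From mathcomp Require Import all_boot all_order all_algebra.
From mathcomp Require Import all_classical all_reals all_analysis.
From mathcomp Require Import complex.
Set Implicit Arguments. Unset Strict Implicit. Unset Printing Implicit Defensive.
Import Order.TTheory GRing.Theory Num.Theory.
Local Open Scope classical_set_scope.
Local Open Scope ring_scope.

Definition primes_upto (N : nat) : seq nat := seq.filter prime (iota 0 N.+1).
Definition primepi (N : nat) : nat := size (primes_upto N).

Definition cabs (R : realType) (z : R[i]) : R := Normc.normc z.

Definition expi (R : realType) (t : R) : R[i] :=
  (cos (2 * pi * t) +i* sin (2 * pi * t))%C.

Definition torus (R : realType) (d : nat) : set (seq R[i]) :=
  [set z | size z = d /\ forall j, (j < d)%N -> cabs (nth 0 z j) = 1].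

(* iterated integral over [0,1[^d of f : seq R -> \bar R (for nonnegative
   measurable f, by Tonelli, the integral against d-fold product Lebesgue
   measure on [0,1[^d). *)
Fixpoint iter_int (R : realType) (d : nat) (f : seq R -> \bar R) : \bar R :=
  match d with
  | 0 => f [::]
  | d'.+1 => (\int[@lebesgue_measure R]_(t in `[0%R, 1%R[)
                 iter_int d' (fun x => f (t :: x)))%E
  end.

(* Normalized Haar measure mu_d on T^d: push-forward of the Lebesgue
   measure on [0,1[^d under theta |-> (e(theta_1), ..., e(theta_d)). *)
Definition haar_torus (R : realType) (d : nat) (A : set (seq R[i])) : \bar R :=
  iter_int d (fun theta => ((\1_A (map (@expi R) theta)) : R)%:E).

Definition zpow (R : realType) (N : nat) (z : seq R[i]) (n : nat) : R[i] :=
  \prod_(j < primepi N) (nth 0 z j) ^+ logn (nth 0 (primes_upto N) j) n.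

Definition Dpoly (R : realType) (N : nat) (a : nat -> R[i]) (z : seq R[i]) : R[i] :=
  \sum_(1 <= n < N.+1) a n * zpow N z n.

Definition sup_norm (R : realType) (N : nat) (a : nat -> R[i]) : R :=
  sup [set cabs (Dpoly N a z) | z in @torus R (primepi N)].

Definition Xlambda (R : realType) (N : nat) (a : nat -> R[i]) (lambda : R)
  : set (seq R[i]) :=
  [set z | @torus R (primepi N) z /\ lambda * sup_norm N a <= cabs (Dpoly N a z)].

(* Main.v *)
(** Write X for the integer part of sqrt N, k = pi(X), l = pi(N) - k, mu = 1 - lambda.
No n <= N is divisible by a product of two primes > X, so F is affine in the last
l variables; turning each of them by at most an angle t from the position that
aligns all terms costs only a factor 1 - t^2/2, however many of them there are.
In the first k variables one moves one variable at a time.  A polynomial P of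
degree m in one variable whose modulus nearly peaks at w satisfies
|P(w e^(it))|^2 >= (1 - (m t)^2/2) max |P|^2 up to a small error, by a
Bernstein-type bound for a second difference.  Allowing each variable a loss mu/k
gives arcs of relative length (mu/pi^2) sqrt(18/k)/m_p, where m_p = floor(log N/log p),
and it remains to see that the product over p <= X of k m_p^2/18 is at most e^(2X).
This follows from k^k <= (e/2)^k prod p and prod p <= 4^X, since a factor
e m_p^2/36 exceeds 1 only for p <= N^(1/4). *)

Require Import Defs.
From HB Require Import structures.
From mathcomp Require Import all_boot all_order all_algebra.
From mathcomp Require Import all_classical all_reals all_analysis.
From mathcomp Require Import measurable_realfun complex ring lra zify.
Import Order.TTheory GRing.Theory Num.Theory.
Import numFieldNormedType.Exports.
Local Open Scope ring_scope.

Set Implicit Arguments. Unset Strict Implicit. Unset Printing Implicit Defensive.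

(** * The unit circle *)

Section circle.
Variable R : realType.
Implicit Types (x y : R) (u z : R[i]).

Lemma sin_le_id x : 0 <= x -> sin x <= x.
Proof.
rewrite le_eqVlt => /predU1P[<-|x0]; first by rewrite sin0.
have [|c _] := @MVT_segment R (@sin R) (@cos R) 0 x (ltW x0)
  (fun x _ => is_derive_sin x).
  by apply: continuous_subspaceT => y; exact: continuous_sin.
by rewrite sin0 !subr0 => ->; apply: ler_piMl; [exact: ltW | exact: cos_le1].
Qed.

Lemma sqr_sin_le x : sin x ^+ 2 <= x ^+ 2.
Proof.
wlog x0 : x / 0 <= x => [hw|].
  have [/hw//|/ltW x0] := leP 0 x.
  by rewrite -(sqrrN x) -(sqrrN (sin x)) -sinN hw ?oppr_ge0.
have := sin_le_id x0; have := sin_geN1 x; have := sin_le1 x.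
have [s0|s0] := leP 0 (sin x); first by move=> *; rewrite ler_sqr.
have [x1 *|x1 *] := leP 1 x; first by nra.
by have := @sin_ge0_pi _ x; have := @pi_ge2 R; lra.
Qed.

Lemma one_sub_cos_le x : 1 - cos x <= x ^+ 2 / 2.
Proof.
have -> : x = (x / 2) *+ 2 by lra.
rewrite cos_mulr2n cos2sin2; have := sqr_sin_le (x / 2); lra.
Qed.

(** For [y = pi / 6] one has [2 y = pi / 2 - y], so [sin (2 y) = cos y] and hence [sin y = 1 / 2];
    now apply [sin y <= y]. *)
Lemma pi_ge3 : 3 <= pi :> R.
Proof.
set y := pi / 6 : R.
have y0 : 0 < y by rewrite divr_gt0 ?pi_gt0.
have y3 : pi / 2 = y *+ 2 + y by rewrite /y; lra.
have y3' : y *+ 2 = pi / 2 - y by lra.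
have hs : sin y = 1 / 2.
  have c0 : 0 < cos y by apply: cos_gt0_pihalf; lra.
  have : sin (y *+ 2) = cos y.
    by rewrite y3' sinB sin_pihalf cos_pihalf; ring.
  rewrite sin_mulr2n => h; apply: (mulfI (lt0r_neq0 c0)); lra.
by have := sin_le_id (ltW y0); rewrite hs /y; lra.
Qed.

Lemma cabs0 : cabs 0 = 0 :> R. Proof. exact: Normc.normc0. Qed.

Lemma cabs1 : cabs 1 = 1 :> R. Proof. exact: Normc.normc1. Qed.

Lemma cabsM u z : cabs (u * z) = cabs u * cabs z.
Proof. exact: Normc.normcM. Qed.

Lemma cabs_ge0 z : 0 <= cabs z.
Proof. by case: z => x y; rewrite /cabs /= sqrtr_ge0. Qed.

Lemma cabsX z n : cabs (z ^+ n) = cabs z ^+ n.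
Proof. by elim: n => [|n IH]; rewrite ?expr0 ?cabs1 // !exprS cabsM IH. Qed.

Lemma cabsMn z n : cabs (z *+ n) = cabs z *+ n.
Proof. exact: complex.normcMn. Qed.

Lemma cabsC x : cabs x%:C%C = `|x|.
Proof. by rewrite /cabs /= expr0n /= addr0 sqrtr_sqr. Qed.

Lemma cabsD u z : cabs (u + z) <= cabs u + cabs z.
Proof. exact: complex.le_normcD. Qed.

Lemma cabs_sum (I : Type) (r : seq I) (P : pred I) (F : I -> R[i]) :
  cabs (\sum_(i <- r | P i) F i) <= \sum_(i <- r | P i) cabs (F i).
Proof.
elim/big_ind2: _ => [|u a v b ua vb|i _]; rewrite ?cabs0 //.
exact: le_trans (cabsD _ _) (lerD ua vb).
Qed.

Lemma Re_le_cabs z : complex.Re z <= cabs z.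
Proof.
case: z => x y; rewrite /cabs /=; apply: le_trans (ler_norm x) _.
by rewrite -sqrtr_sqr ler_wsqrtr // lerDl sqr_ge0.
Qed.

Lemma expi0 : expi 0 = 1 :> R[i].
Proof. by rewrite /expi mulr0 cos0 sin0. Qed.

Lemma expiD x y : expi (x + y) = expi x * expi y.
Proof.
rewrite /expi mulrDr cosD sinD; apply/eqP; rewrite eq_complex /=.
by apply/andP; split; apply/eqP; ring.
Qed.

Lemma expi1 : expi 1 = 1 :> R[i].
Proof. by rewrite /expi mulr1 mulr_natl cos2pi sin2pi. Qed.

Lemma expiMn x n : expi (x *+ n) = expi x ^+ n.
Proof.
by elim: n => [|n IH]; rewrite ?mulr0n ?expi0 // mulrS expiD IH exprS.
Qed.

Lemma cabs_expi x : cabs (expi x) = 1.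
Proof. by rewrite /cabs /= cos2Dsin2 sqrtr1. Qed.

Lemma expi_neq0 x : expi x != 0.
Proof.
by apply/eqP => h; have /eqP := cabs_expi x; rewrite h cabs0 eq_sym oner_eq0.
Qed.

Lemma expiN x : expi (- x) = (expi x)^-1.
Proof.
apply: (mulfI (expi_neq0 x)); rewrite -expiD subrr expi0 divff //.
exact: expi_neq0.
Qed.

Lemma expi_neq1 x : 0 < x < 1 -> expi x != 1.
Proof.
move=> /andP[x0 x1]; apply/eqP => /(congr1 (@complex.Re _)) /=.
have -> : 2 * pi * x = (pi * x) *+ 2 by ring.
rewrite cos_mulr2n cos2sin2 => h.
have : 0 < sin (pi * x).
  by apply: sin_gt0_pi; rewrite mulr_gt0 ?pi_gt0 //= gtr_pMr ?pi_gt0.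
by nra.
Qed.

Lemma circle_expi u : cabs u = 1 -> exists2 a, 0 <= a < 1 & u = expi a.
Proof.
case: u => x y; rewrite /cabs /= => h.
have xy : x ^+ 2 + y ^+ 2 = 1.
  by rewrite -[LHS]sqr_sqrtr ?addr_ge0 ?sqr_ge0 // h expr1n.
have x1 : -1 <= x <= 1 by apply/andP; split; nra.
pose t := acos x / (2 * pi).
have pi0 : 0 < pi :> R := pi_gt0 R.
have tE : 2 * pi * t = acos x by rewrite /t mulrC divfK // gt_eqF // mulr_gt0.
have t0 : 0 <= t by rewrite divr_ge0 ?acos_ge0 // ltW // mulr_gt0.
have t1 : t <= 1 / 2.
  have := acos_lepi x1; rewrite -tE; nra.
have ct : cos (2 * pi * t) = x by rewrite tE acosK // in_itv.
have st : sin (2 * pi * t) = `|y|.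
  by rewrite tE sin_acos // -xy addrC addKr sqrtr_sqr.
have [y0|y0] := leP 0 y.
  exists t; first by rewrite t0 /=; lra.
  by rewrite /expi ct st ger0_norm.
(* The reflected angle [1 - t] must stay below 1, so [t = 0] has to be excluded; there [y] would
   vanish. *)
have tp : 0 < t.
  rewrite lt0r t0 andbT; apply/eqP => e.
  by move: st y0; rewrite e mulr0 sin0 => /esym/eqP; rewrite normr_eq0 => /eqP ->;
    rewrite ltxx.
exists (1 - t); first by lra.
rewrite expiD expi1 mul1r /expi mulrN cosN sinN ct st ltr0_norm // opprK //.
Qed.

End circle.

(** * A Bernstein-type inequality *)

Section bernstein.
Variable R : realType.
Implicit Types (x t : R).

Lemma sum_expi_eq0 (m : nat) (x : R) :
  expi x != 1 -> expi (x *+ m) = 1 -> \sum_(0 <= n < m) expi (x *+ n) = 0.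
Proof.
move=> x1 xm; have /eqP := subrX1 (expi x) m.
rewrite -expiMn xm subrr eq_sym mulf_eq0 subr_eq0 (negPf x1) /= => /eqP h.
rewrite big_mkord -[RHS]h; apply: eq_bigr => i _; exact: expiMn.
Qed.

Lemma expi_nat (n : nat) : expi (n%:R : R) = 1.
Proof. by rewrite -mulr_natl mulr1 -[in LHS](mulr1 n%:R) mulr_natl expiMn expi1 expr1n. Qed.

Lemma expi_diff_neq1 (m k l : nat) : (k < m)%N -> (l < m)%N -> k != l ->
  expi ((k%:R - l%:R) / m%:R : R) != 1.
Proof.
move=> km lm; wlog kl : k l km lm / (l < k)%N => [hw|_].
  rewrite neq_ltn => /orP[kl|lk]; last by apply: hw => //; rewrite neq_ltn lk orbT.
  rewrite -opprB mulNr expiN invr_eq1; apply: hw => //; by rewrite neq_ltn kl orbT.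
apply: expi_neq1; have m0 : 0 < m%:R :> R by rewrite ltr0n; lia.
rewrite ltr_pdivrMr // mul1r divr_gt0 ?subr_gt0 ?ltr_nat //=.
by rewrite ltrBlDr -natrD ltr_nat; lia.
Qed.

(** Orthogonality of the characters of Z/m; it inverts the Fourier transform in [sum_beta_expi]. *)
Lemma sum_expi_diff (m k l : nat) : (k < m)%N -> (l < m)%N ->
  \sum_(0 <= n < m) expi (((k%:R - l%:R) / m%:R : R) *+ n) = (m * (k == l))%:R.
Proof.
move=> km lm; have [->|kl] := eqVneq k l.
  rewrite subrr mul0r muln1 (eq_bigr (fun=> 1)).
    by rewrite sumr_const_nat subn0.
  by move=> n _; rewrite mul0rn expi0.
rewrite muln0; apply: sum_expi_eq0; first exact: expi_diff_neq1.
have -> : (k%:R - l%:R) / m%:R *+ m = k%:R - l%:R :> R.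
  by rewrite -mulr_natr divfK // pnatr_eq0; lia.
by rewrite expiD expiN !expi_nat invr1 mulr1.
Qed.

(** * A second-difference multiplier and its discrete Fourier transform *)

Section kernel.
Variables (m : nat) (t : R).
Hypothesis m0 : (0 < m)%N.

Let C x := cos ((x - m%:R / 2) * t).

(* The factor [2 (cos t - cos a)] turns the summand into a difference
   [U (l + 1) - U l]. *)
Lemma sum_cos_telescope (a : R) : cos (a * m%:R) = 1 -> sin (a * m%:R) = 0 ->
  2 * (cos t - cos a) * (\sum_(0 <= l < m) C l%:R * cos (a * l%:R)) =
  C (- 1) - C (m%:R - 1).
Proof.
move=> ca sa.
pose U x := C x * cos (a * (x - 1)) - C (x - 1) * cos (a * x).
transitivity (\sum_(0 <= l < m) (U l.+1%:R - U l%:R)).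
  rewrite big_distrr /=; apply: eq_bigr => l _; rewrite /U /C -[l.+1%:R]natr1.
  have -> : l%:R + 1 - 1 = l%:R :> R by ring.
  set y := l%:R - m%:R / 2.
  have -> : (l%:R + 1 - m%:R / 2) * t = y * t + t by rewrite /y; ring.
  have -> : (l%:R - 1 - m%:R / 2) * t = y * t - t by rewrite /y; ring.
  have -> : a * (l%:R + 1) = a * l%:R + a by ring.
  have -> : a * (l%:R - 1) = a * l%:R - a by ring.
  rewrite !cosD !cosN !sinN; ring.
rewrite telescope_sumr // /U /C mulr0 cos0 ca.
have -> : a * (m%:R - 1) = a * m%:R - a by ring.
have -> : a * (0 - 1) = - a by ring.
have -> : (m%:R - m%:R / 2) * t = - ((0 - m%:R / 2) * t) by field.
rewrite cosB ca sa !sub0r !cosN; ring.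
Qed.

Hypothesis mt : `|m%:R * t| <= pi.

(** For [0 <= l < m] the argument of the cosine is at most [|m t| / 2 <= pi / 2] in absolute
    value. *)
Let C_ge0 (l : nat) : (l < m)%N -> 0 <= C l%:R.
Proof.
move=> lm; apply: cos_ge0_pihalf; rewrite -ler_norml.
have -> : (l%:R - m%:R / 2) * t = ((l%:R *+ 2 - m%:R) / m%:R) * (m%:R * t) / 2.
  by field; rewrite pnatr_eq0; lia.
rewrite normrM [`|2^-1|]ger0_norm // ler_pM2r // normrM.
apply: le_trans mt; apply: ler_piMl => //.
rewrite normrM normfV [X in _ / X]ger0_norm //.
rewrite ler_pdivrMr ?ltr0n // mul1r ler_norml.
have : l%:R <= m%:R :> R by rewrite ler_nat ltnW.
have : 0 <= l%:R :> R by []. lra.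
Qed.

(* The multiplier of the second difference at 0, with step t, of the function
   e^(-i m x/2) P(e^(i x)) for P of degree m. *)
Definition phi x : R := 2 - 2 * C x.

Lemma phi_ge0 x : 0 <= phi x.
Proof. by rewrite /phi; have := cos_le1 ((x - m%:R / 2) * t); rewrite -/(C x); lra. Qed.

Lemma phi_sym x : phi (m%:R - x) = phi x.
Proof.
by rewrite /phi /C -cosN; congr (2 - 2 * cos _); field.
Qed.

Let alpha (n : nat) : R := 2 * pi * (n%:R / m%:R).

(* The discrete Fourier transform of [phi] on Z/m; as it is nonnegative, its
   total variation is just [phi 0]. *)
Definition beta (n : nat) : R :=
  m%:R^-1 * \sum_(0 <= l < m) phi l%:R * cos (alpha n * l%:R).

Let alpham (n : nat) : alpha n * m%:R = 2 * pi * n%:R.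
Proof. by rewrite /alpha; field; rewrite pnatr_eq0; lia. Qed.

Let cos_alpham (n : nat) : cos (alpha n * m%:R) = 1.
Proof. by rewrite alpham; have /(congr1 (@complex.Re _)) := expi_nat n. Qed.

Let sin_alpham (n : nat) : sin (alpha n * m%:R) = 0.
Proof. by rewrite alpham; have /(congr1 (@complex.Im _)) := expi_nat n. Qed.

(** Let [Y] and [Z] be the sums of [C l] without and with the weight [cos (a l)]. Telescoping gives
    [(cos t - cos a) Z = (cos t - 1) Y], and [Z <= Y] because [C l >= 0], so [Z <= 0]. For [n != 0]
    the constant 2 in [phi] sums to zero against the cosines, whence [m beta n = - 2 Z]. *)
Lemma beta_ge0 (n : nat) : (n < m)%N -> 0 <= beta n.
Proof.
move=> nm; rewrite /beta mulr_ge0 ?invr_ge0 //.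
have [->|n0] := eqVneq n 0%N.
  apply: sumr_ge0 => l _; rewrite /alpha mul0r mulr0 mul0r cos0 mulr1.
  exact: phi_ge0.
set a := alpha n.
have e1 : expi (n%:R / m%:R : R) != 1.
  by have := @expi_diff_neq1 m n 0 nm m0 n0; rewrite subr0.
have ca1 : cos a < 1.
  rewrite lt_neqAle cos_le1 andbT; apply: contra e1 => /eqP h.
  have s : sin a = 0 by apply: cos1sin0; rewrite h normr1.
  by rewrite /expi -/(alpha n) -/a h s.
have sc : \sum_(0 <= l < m) cos (a * l%:R) = 0.
  have /(congr1 (@complex.Re _)) := @sum_expi_diff m n 0 nm m0.
  rewrite (negPf n0) muln0 subr0 /= raddf_sum /= => h.
  rewrite -[RHS]h; apply: eq_bigr => l _; congr cos.
  by rewrite /a /alpha -mulr_natr; ring.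
have hZ := sum_cos_telescope (cos_alpham n) (sin_alpham n).
have hY := @sum_cos_telescope 0; rewrite !mul0r cos0 sin0 in hY.
have {hY} := hY erefl erefl.
rewrite -{}hZ -/a; set Y := \sum_(0 <= l < m) _; set Z := \sum_(0 <= l < m) _.
have YZ : Z <= Y.
  rewrite /Y /Z !big_mkord; apply: ler_sum => l _; rewrite mul0r cos0 mulr1.
  by apply: ler_piMr; [exact: C_ge0 | exact: cos_le1].
move=> h; have Z0 : Z <= 0.
  (* [hZ] and its analogue for a = 0 have the same right-hand side. *)
  have : (1 - cos a) * Z = (1 - cos t) * (Z - Y) by lra.
  have := cos_le1 t; nra.
rewrite (eq_bigr (fun l : nat => 2 * cos (a * l%:R) - 2 * (C l%:R * cos (a * l%:R)))).
  by rewrite sumrB -!mulr_sumr sc -/Z; lra.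
by move=> l _; rewrite /phi; ring.
Qed.

(** The summand changes sign under [x -> m - x], by [phi_sym], and vanishes at both 0 and [m], so
    the sum equals its own negative. *)
Lemma sum_phi_sin (n : nat) : \sum_(0 <= l < m) phi l%:R * sin (alpha n * l%:R) = 0.
Proof.
pose g x := phi x * sin (alpha n * x).
have refl x : g (m%:R - x) = - g x.
  rewrite /g phi_sym mulrBr sinB cos_alpham sin_alpham; ring.
set S := LHS.
have h1 : S = - \sum_(0 <= l < m) g l.+1%:R.
  rewrite /S big_nat_rev /= add0n -sumrN; apply: eq_big_nat => l /andP[_ lm].
  by rewrite natrB // -/(g _) refl.
have h2 : \sum_(0 <= l < m) g l.+1%:R = S.
  apply/eqP; rewrite -subr_eq0 -sumrB telescope_sumr //.
  by rewrite /g sin_alpham !mulr0 sin0 mulr0 subrr.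
by move: h1; rewrite h2; lra.
Qed.

Lemma betaC (n : nat) : (beta n)%:C%C =
  m%:R^-1 * \sum_(0 <= l < m) (phi l%:R)%:C%C * expi (- (n%:R * l%:R / m%:R)).
Proof.
have -> : \sum_(0 <= l < m) (phi l%:R)%:C%C * expi (- (n%:R * l%:R / m%:R)) =
    (\sum_(0 <= l < m) phi l%:R * cos (alpha n * l%:R))%:C%C
    - 'i%C * (\sum_(0 <= l < m) phi l%:R * sin (alpha n * l%:R))%:C%C.
  rewrite !rmorph_sum mulr_sumr -sumrB; apply: eq_bigr => l _.
  have -> : alpha n * l%:R = 2 * pi * (n%:R * l%:R / m%:R) by rewrite /alpha; ring.
  rewrite /expi mulrN cosN sinN; apply/eqP; rewrite eq_complex /=.
  by apply/andP; split; apply/eqP; ring.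
by rewrite sum_phi_sin rmorph0 mulr0 subr0 /beta rmorphM fmorphV rmorph_nat.
Qed.

(** Fourier inversion on Z/m. The endpoint [k = m] is included because a polynomial of degree [m]
    has [m + 1] coefficients. *)
Lemma sum_beta_expi (k : nat) : (k <= m)%N ->
  \sum_(0 <= n < m) (beta n)%:C%C * expi (n%:R * k%:R / m%:R) = (phi k%:R)%:C%C.
Proof.
move=> km; have mR : m%:R != 0 :> R by rewrite pnatr_eq0; lia.
have mC : m%:R != 0 :> R[i] by rewrite pnatr_eq0; lia.
have main j : (j < m)%N ->
    \sum_(0 <= n < m) (beta n)%:C%C * expi (n%:R * j%:R / m%:R) = (phi j%:R)%:C%C.
  move=> jm; under eq_bigr do rewrite betaC -[_ * _ * expi _]mulrA mulr_suml.
  rewrite -mulr_sumr.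
  rewrite exchange_big_nat /=.
  rewrite (eq_big_nat _ _ (F2 := fun l => (phi l%:R)%:C%C * (m * (j == l))%:R)).
    rewrite big_mkord (bigD1 (Ordinal jm)) //= eqxx muln1 big1 ?addr0.
      by rewrite mulrCA mulVf ?mulr1.
    move=> i /eqP ij; have /negPf -> : j != i.
      by apply/eqP => e; apply: ij; apply: val_inj.
    by rewrite muln0 mulr0.
  move=> l /andP[_ lm]; rewrite -sum_expi_diff // mulr_sumr; apply: eq_bigr => n _.
  rewrite -mulrA -expiD; congr (_ * expi _); rewrite -mulr_natr; by field.
(* At [k = m] the exponentials are those of [k = 0], and [phi] takes the same value at both ends. *)
move: km; rewrite leq_eqVlt => /orP[/eqP->|]; last exact: main.
rewrite -[m%:R in RHS](subr0) phi_sym -(main 0%N m0).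
apply: eq_bigr => n _; rewrite mulfK // mulr0 mul0r expi0 expi_nat //.
Qed.

End kernel.

(** * Second differences of polynomials on the circle *)

Lemma sum_beta (m : nat) (t : R) : (0 < m)%N -> `|m%:R * t| <= pi ->
  \sum_(0 <= n < m) beta m t n = phi m t 0.
Proof.
move=> m0 mt; have /(congr1 (@complex.Re _)) /= := sum_beta_expi m0 mt (leq0n m).
rewrite raddf_sum /= => <-; apply: eq_bigr => n _.
by rewrite mulr0 mul0r mulr0 cos0 sin0 mulr0 subr0 mulr1.
Qed.

(** By [sum_beta_expi] the second difference is a combination of the rotated values
    [P (w * expi (n / m))] with weights [beta n >= 0] of total mass [phi 0]; the triangle inequality
    concludes. *)
Lemma bernstein_second_difference (m : nat) (b : nat -> R[i]) (w : R[i]) (s M : R) :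
  let P w := \sum_(0 <= k < m.+1) b k * w ^+ k in
  (0 < m)%N -> `|m%:R * s| <= 1 / 2 -> cabs w = 1 ->
  (forall z, cabs z = 1 -> cabs (P z) <= M) ->
  cabs (2 * P w - expi (- (m%:R / 2 * s)) * P (w * expi s)
      - expi (m%:R / 2 * s) * P (w * expi (- s)))
  <= phi m (2 * pi * s) 0 * M.
Proof.
move=> P m0 ms w1 hM; set D := (X in cabs X).
have mR : m%:R != 0 :> R by rewrite pnatr_eq0; lia.
have mt : `|m%:R * (2 * pi * s)| <= pi.
  have -> : m%:R * (2 * pi * s) = 2 * pi * (m%:R * s) by ring.
  rewrite normrM gtr0_norm ?mulr_gt0 ?pi_gt0 //; have := pi_gt0 R; nra.
have -> : D = \sum_(0 <= n < m) (beta m (2 * pi * s) n)%:C%C * P (w * expi (n%:R / m%:R)).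
  under eq_bigr do rewrite mulr_sumr.
  rewrite exchange_big_nat /= /D /P !mulr_sumr -!sumrB.
  apply: eq_big_nat => k /andP[_ km].
  rewrite (eq_bigr (fun n : nat => b k * w ^+ k *
      ((beta m (2 * pi * s) n)%:C%C * expi (n%:R * k%:R / m%:R)))).
    rewrite -mulr_sumr sum_beta_expi // !exprMn -!expiMn.
    have -> : (phi m (2 * pi * s) k%:R)%:C%C =
       2 - expi (- (m%:R / 2 * s)) * expi (s *+ k) - expi (m%:R / 2 * s) * expi (- s *+ k).
      rewrite -!expiD /phi.
      have -> : - (m%:R / 2 * s) + s *+ k = (k%:R - m%:R / 2) * s.
        by rewrite -mulr_natl; ring.
      have -> : m%:R / 2 * s + - s *+ k = - ((k%:R - m%:R / 2) * s).
        by rewrite -mulr_natl; ring.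
      rewrite /expi mulrN cosN sinN mulrCA; apply/eqP; rewrite eq_complex /=.
      by apply/andP; split; apply/eqP; rewrite ?raddfD /=; ring.
    ring.
  move=> n _; rewrite exprMn -expiMn.
  have -> : n%:R / m%:R *+ k = n%:R * k%:R / m%:R :> R.
    by rewrite -mulr_natr; field.
  ring.
apply: le_trans (cabs_sum _ _ _) _.
rewrite -sum_beta // mulr_suml !big_mkord; apply: ler_sum => n _.
rewrite cabsM cabsC ger0_norm ?beta_ge0 //; apply: ler_wpM2l; first exact: beta_ge0.
by apply: hM; rewrite cabsM w1 cabs_expi mulr1.
Qed.

(** With [a = |P w|], rotated terms [u], [v] and second difference of modulus [d], one has
    [2 a <= |u| + |v| + d] and [a d <= phi 0 * G]. Squaring, with
    [(|u| + |v|)^2 <= 2 (|u|^2 + |v|^2)] and [|v|^2 <= G], isolates [|u|^2]. *)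
Lemma bernstein_near_max (m : nat) (b : nat -> R[i]) (w : R[i]) (s G : R) :
  let P w := \sum_(0 <= k < m.+1) b k * w ^+ k in
  (0 < m)%N -> `|m%:R * s| <= 1 / 2 -> cabs w = 1 ->
  (forall z, cabs z = 1 -> cabs (P z) ^+ 2 <= G) ->
  2 * cabs (P w) ^+ 2 - G - (2 * pi * (m%:R * s)) ^+ 2 / 2 * G
    <= cabs (P (w * expi s)) ^+ 2.
Proof.
move=> P m0 ms w1 hG.
have G0 : 0 <= G by apply: le_trans (hG _ w1); exact: sqr_ge0.
have hM z : cabs z = 1 -> cabs (P z) <= Num.sqrt G.
  by move=> /hG h; rewrite -[leLHS]ger0_norm ?cabs_ge0 // -sqrtr_sqr ler_wsqrtr.
have := bernstein_second_difference m0 ms w1 hM.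
rewrite -/(P _) -/(P (w * expi s)) -/(P (w * expi (- s))).
set u := expi _ * _; set v := expi _ * P (w * expi (- s)); set D := _ - v => hD.
have uE : cabs u = cabs (P (w * expi s)) by rewrite /u cabsM cabs_expi mul1r.
have v1 : cabs v ^+ 2 <= G.
  by rewrite /v cabsM cabs_expi mul1r; apply: hG; rewrite cabsM w1 cabs_expi mulr1.
rewrite -uE; have {hM} := hM _ w1; set a := cabs (P w) => hM.
have tri : 2 * a <= cabs u + cabs v + cabs D.
  have -> : 2 * a = cabs (u + v + D).
    have -> : u + v + D = P w *+ 2 by rewrite /D; ring.
    by rewrite cabsMn mulr_natl.
  by apply: le_trans (cabsD _ _) _; rewrite lerD2r cabsD.
have ph : phi m (2 * pi * s) 0 <= (2 * pi * (m%:R * s)) ^+ 2 / 4.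
  have := one_sub_cos_le ((0 - m%:R / 2) * (2 * pi * s)); rewrite /phi.
  have -> : ((0 - m%:R / 2) * (2 * pi * s)) ^+ 2 = (2 * pi * (m%:R * s)) ^+ 2 / 4 by field.
  lra.
have ph0 := phi_ge0 m (2 * pi * s) 0.
have sG := sqr_sqrtr G0; have sG0 := sqrtr_ge0 G.
have a0 : 0 <= a by exact: cabs_ge0.
have [[u0 v0] D0] := (cabs_ge0 u, cabs_ge0 v, cabs_ge0 D).
set d := cabs D in hD tri D0.
set p := phi _ _ _ in ph ph0 hD.
have aD : a * d <= p * G.
  rewrite -sG expr2 mulrCA mulrA mulrC; apply: ler_pM => //; lra.
suff : 2 * a ^+ 2 - 2 * (a * d) <= cabs u ^+ 2 + cabs v ^+ 2.
  have : p * G <= (2 * pi * (m%:R * s)) ^+ 2 / 4 * G by exact: ler_wpM2r.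
  lra.
have : (cabs u + cabs v) ^+ 2 <= 2 * (cabs u ^+ 2 + cabs v ^+ 2).
  by have := sqr_ge0 (cabs u - cabs v); nra.
(* Squaring needs [2 a - d >= 0]; for [d > 2 a] the left-hand side is nonpositive. *)
have [h|h] := leP d (2 * a); last by nra.
have : (2 * a - d) ^+ 2 <= (cabs u + cabs v) ^+ 2.
  by rewrite ler_sqr ?nnegrE; lra.
nra.
Qed.

End bernstein.

(** * Lower bounds for iterated integrals *)

Section iterated_integral.
Local Open Scope classical_set_scope.
Variable R : realType.
Local Notation mu := (@lebesgue_measure R).
Implicit Types (f : seq R -> \bar R).

(* [ge0_le_integral] asks for measurability; the slices of the iterated
   integral are only bounded below, so none is available here. *)
Lemma ge0_le_integral_nomeas (D : set R) (f g : R -> \bar R) :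
  (forall x, D x -> 0 <= f x)%E -> (forall x, D x -> f x <= g x)%E ->
  (\int[mu]_(x in D) f x <= \int[mu]_(x in D) g x)%E.
Proof.
move=> f0 fg; rewrite !ge0_integralE //; last first.
  by move=> x Dx; apply: le_trans (f0 _ Dx) (fg _ Dx).
apply: le_ereal_sup => _ [h /= hf <-]; exists h => //= x.
apply: le_trans (hf x) _; rewrite /patch; case: ifPn => //.
by rewrite inE => /fg.
Qed.

Lemma integral_unit_ge (E : set R) (f : R -> \bar R) (c : R) :
  measurable E -> E `<=` `[0%R, 1%R[ -> 0 <= c -> (forall x, 0 <= f x)%E ->
  (forall x, E x -> c%:E <= f x)%E ->
  (c%:E * mu E <= \int[mu]_(x in `[0%R, 1%R[) f x)%E.
Proof.
move=> mE E1 c0 f0 cf.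
have -> : (c%:E * mu E = \int[mu]_(x in `[0%R, 1%R[) (c%:E * (\1_E x)%:E))%E.
  rewrite ge0_integralZl_EFin //.
    by rewrite integral_indic //; congr (_ * mu _)%E; apply/esym/setIidPl.
  by apply/measurable_EFinP; exact: measurable_indic.
apply: ge0_le_integral_nomeas => x _; first by rewrite mule_ge0 ?lee_fin.
rewrite indicE; case: (boolP (x \in E)) => [|_]; last by rewrite mule0.
by rewrite inE mule1 => /cf.
Qed.

Lemma iter_int_ge0 (d : nat) f : (forall x, 0 <= f x)%E -> (0 <= iter_int d f)%E.
Proof.
elim: d f => [|d IH] f f0 /=; first exact: f0.
by apply: integral_ge0 => t _; apply: IH.
Qed.

Lemma iter_int_cons_ge (d : nat) f (E : set R) (c e : R) :
  (forall x, 0 <= f x)%E -> measurable E -> E `<=` `[0%R, 1%R[ -> mu E = e%:E ->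
  0 <= c -> (forall t, E t -> c%:E <= iter_int d (fun x => f (t :: x)))%E ->
  ((e * c)%:E <= iter_int d.+1 f)%E.
Proof.
move=> f0 mE E1 eE c0 h; rewrite mulrC EFinM -eE /=.
by apply: integral_unit_ge => // t; apply: iter_int_ge0.
Qed.

(** The arc centred at [u] starts at the angle [a] of [u * expi (- h)]. If it runs past 1, it wraps
    around and [E] consists of two intervals, disjoint because [2 h <= 1]. *)
Lemma circle_arc (u : R[i]) (h : R) : cabs u = 1 -> 0 <= h <= 1 / 2 ->
  exists E : set R, [/\ measurable E, E `<=` `[0%R, 1%R[, mu E = (2 * h)%:E &
    forall t, E t -> exists2 s, `|s| <= h & expi t = u * expi s].
Proof.
move=> u1 /andP[h0 h1].
have [|a /andP[a0 a1] ua] := @circle_expi _ (u * expi (- h)).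
  by rewrite cabsM u1 cabs_expi mulr1.
have uE : u = expi (a + h).
  by rewrite expiD -ua -mulrA -expiD addNr expi0 mulr1.
have [ah|ah] := leP (a + 2 * h) 1.
  exists `[a, (a + 2 * h)[; split => //.
  - move=> t /=; rewrite !in_itv /= => /andP[? ?]; lra.
  - rewrite lebesgue_measure_itv /= lte_fin; case: ltP => [_|].
      by rewrite -EFinD; congr EFin; lra.
    by move=> ?; congr EFin; lra.
  - move=> t /=; rewrite in_itv /= => /andP[? ?].
    exists (t - (a + h)); first by rewrite ler_norml; lra.
    by rewrite uE -expiD addrC subrK.
exists (`[a, 1%R[ `|` `[0%R, (a + 2 * h - 1)[); split => //.
- exact: measurableU.
- by move=> t /= []; rewrite !in_itv /= => /andP[? ?]; lra.
- rewrite measureU //; last first.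
    apply/seteqP; split => // t /= []; rewrite !in_itv /= => /andP[? ?] /andP[? ?]; lra.
  have e1 : mu `[a, 1%R[ = (1 - a)%:E by rewrite lebesgue_measure_itv /= lte_fin a1.
  have e2 : mu `[0%R, (a + 2 * h - 1)[ = (a + 2 * h - 1)%:E.
    by rewrite lebesgue_measure_itv /= lte_fin subr_gt0 ah oppr0 adde0.
  transitivity ((1 - a)%:E + (a + 2 * h - 1)%:E)%E; first by rewrite -e1 -e2.
  by rewrite -EFinD; congr EFin; lra.
move=> t /= []; rewrite in_itv /= => /andP[? ?].
  exists (t - (a + h)); first by rewrite ler_norml; lra.
  by rewrite uE -expiD addrC subrK.
exists (t + 1 - (a + h)); first by rewrite ler_norml; lra.
by rewrite uE -expiD addrC subrK expiD expi1 mulr1.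
Qed.

Lemma iter_int_indic_prod_ge (d : nat) (P : set (seq R)) (E : nat -> set R) (e : R) :
  0 <= e ->
  (forall j, measurable (E j)) -> (forall j, E j `<=` `[0%R, 1%R[) ->
  (forall j, mu (E j) = e%:E) ->
  (forall x, size x = d -> (forall j, (j < d)%N -> E j (nth 0 x j)) -> P x) ->
  ((e ^+ d)%:E <= iter_int d (fun x => (\1_P x)%:E))%E.
Proof.
move=> e0; elim: d P E => [|d IH] P E mE E1 eE hP.
  by rewrite /= indicE mem_set ?expr0 //; exact: hP.
rewrite exprS; apply: (iter_int_cons_ge (E := E 0%N)) => //.
  by rewrite exprn_ge0.
move=> t Et.
have -> : (fun x => (\1_P (t :: x))%:E) =
    (fun x => (\1_[set x | P (t :: x)] x)%:E : \bar R).
  by apply/funext => x; rewrite !indicE; congr (_ %:R)%:E; apply/idP/idP; rewrite !inE.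
apply: (IH _ (fun j => E j.+1)) => // x sx hx /=; apply: hP; first by rewrite /= sx.
by case=> [//|j]; rewrite ltnS => /hx.
Qed.

End iterated_integral.

(** * Large values of polynomials on the torus *)

Section large_values.
Local Open Scope classical_set_scope.
Variable R : realType.
Implicit Types (r : seq nat) (c : nat -> R[i]) (e : nat -> nat -> nat) (z : seq R[i]).

(** Coefficients and exponents are arbitrary functions on an index list, so that fixing the first
    variable yields a sum of the same shape, with that variable absorbed into [c]. *)
Definition mpol r c e (d : nat) z : R[i] :=
  \sum_(n <- r) c n * \prod_(j < d) nth 0 z j ^+ e n j.

Lemma mpol_cons r c e d (w : R[i]) z :
  mpol r c e d.+1 (w :: z) =
  mpol r (fun n => c n * w ^+ e n 0%N) (fun n j => e n j.+1) d z.
Proof. by apply: eq_bigr => n _; rewrite big_ord_recl /= mulrA. Qed.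

Lemma mpol_cons_poly r c e d (m : nat) z : (forall n, n \in r -> (e n 0%N <= m)%N) ->
  exists b : nat -> R[i], forall w,
    mpol r c e d.+1 (w :: z) = \sum_(0 <= k < m.+1) b k * w ^+ k.
Proof.
move=> em; pose F n := c n * \prod_(j < d) nth 0 z j ^+ e n j.+1.
exists (fun k => \sum_(n <- r | e n 0%N == k) F n) => w.
under eq_bigr do rewrite mulr_suml big_mkcond.
rewrite exchange_big /=; apply: eq_big_seq => n nr.
have km : (e n 0%N < m.+1)%N by rewrite ltnS em.
rewrite big_mkord [RHS](bigD1 (Ordinal km)) //= eqxx [X in _ + X]big1 ?addr0.
  by rewrite big_ord_recl /= /F -mulrA; congr (_ * _); rewrite mulrC.
by move=> k /eqP kn; case: eqP => // ek; case: kn; apply: val_inj.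
Qed.

Lemma cabs_mpol_le r c e d z : torus d z ->
  cabs (mpol r c e d z) <= \sum_(n <- r) cabs (c n).
Proof.
move=> [_ z1]; apply: le_trans (cabs_sum _ _ _) _.
apply: ler_sum => n _; rewrite cabsM.
rewrite (big_morph (@cabs R) (@cabsM R) (@cabs1 R)) big1 ?mulr1 // => j _.
by rewrite cabsX z1 // expr1n.
Qed.

Lemma torus_cons d (w : R[i]) z : cabs w = 1 -> torus d z -> torus d.+1 (w :: z).
Proof. by move=> w1 [sz hz]; split; [rewrite /= sz | case]. Qed.

Lemma torus_nseq d : torus d (nseq d (1 : R[i])).
Proof. by split=> [|j jd]; rewrite ?size_nseq // nth_nseq jd cabs1. Qed.

Lemma polar (b : R[i]) : exists2 v, cabs v = 1 & b = (cabs b)%:C%C * v.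
Proof.
have [->|b0] := eqVneq b 0; first by exists 1; rewrite ?cabs1 // cabs0 rmorph0 mul0r.
have cb : cabs b != 0 by apply: contra b0 => /eqP h; apply/eqP; exact: Normc.eq0_normc.
exists (b / (cabs b)%:C%C).
  rewrite cabsM -fmorphV cabsC ger0_norm ?invr_ge0 ?cabs_ge0 // divff //.
by rewrite mulrC divfK // -(rmorph0 (real_complex R)) (inj_eq (@complexI R)).
Qed.

(* The suprema below need not be attained a priori, so "sup |f|^2 >= A on T^d"
   is phrased through the values below [A]. *)
Definition sup_sqr_ge d (f : seq R[i] -> R[i]) (A : R) :=
  forall B, B < A -> exists2 z, torus d z & B < cabs (f z) ^+ 2.

Lemma mpol_affine r c e l :
  (forall n, n \in r -> (\sum_(j < l) e n j <= 1)%N) ->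
  exists (b : R[i]) (a : nat -> R[i]), forall z,
    mpol r c e l z = b + \sum_(j < l) a j * nth 0 z j.
Proof.
(* The truncated [1 - \sum e] is 1 on constant monomials and 0 on linear ones. *)
move=> he; exists (\sum_(n <- r) c n * (1 - \sum_(j < l) e n j)%:R).
exists (fun j => \sum_(n <- r) c n * (e n j)%:R) => z.
rewrite [X in _ + X](eq_bigr (fun j : 'I_l => \sum_(n <- r) c n * (e n j)%:R * nth 0 z j));
  last by move=> j _; rewrite mulr_suml.
rewrite exchange_big -big_split /=; apply: eq_big_seq => n nr.
rewrite [X in _ = _ + X](eq_bigr (fun j : 'I_l => c n * ((e n j)%:R * nth 0 z j)));
  last by move=> j _; rewrite mulrA.
rewrite -mulr_sumr -mulrDr; congr (_ * _).
have {he} := he _ nr; rewrite leq_eqVlt ltnS leqn0 => /orP[h1|h0].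
  rewrite (eqP h1) subnn add0r; case/sum_nat_eq1: h1 => i [_ ei hi].
  rewrite (bigD1 i) //= big1; last by move=> j ji; rewrite hi.
  rewrite [RHS](bigD1 i) //= big1; last by move=> j ji; rewrite hi // mul0r.
  by rewrite ei expr1 mulr1 mul1r addr0.
rewrite (eqP h0) subn0; move: h0; rewrite sum_nat_eq0 => /forallP h0.
have h j : e n (val (j : 'I_l)) = 0%N by have /eqP := h0 j.
by rewrite !big1 ?addr0 // => j _; rewrite h ?expr0 ?mul0r.
Qed.

(** The modulus never exceeds [S = |b| + \sum |a j|], the value when all terms share the direction
    [v] of [b]. Turning each term by at most [2 pi h] from there keeps its component along [v] at
    least [L] times its modulus, so the sum loses the factor [L] for every [l]. *)
Lemma affine_large_values (l : nat) (b : R[i]) (a : nat -> R[i]) (A h L : R) :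
  sup_sqr_ge l (fun z => b + \sum_(j < l) a j * nth 0 z j) A ->
  0 <= h <= 1 / 2 -> 0 <= L <= 1 - (2 * pi * h) ^+ 2 / 2 ->
  (((2 * h) ^+ l)%:E <= iter_int l (fun x =>
     (\1_[set x | A * L ^+ 2
                 <= cabs (b + \sum_(j < l) a j * nth 0 (map (@expi R) x) j) ^+ 2]%R x)%:E))%E.
Proof.
move=> hA h01 /andP[L0 L1]; have /andP[h0 h1] := h01.
pose S := cabs b + \sum_(j < l) cabs (a j).
have S0 : 0 <= S by rewrite addr_ge0 ?cabs_ge0 ?sumr_ge0 // => j _; exact: cabs_ge0.
have AS : A <= S ^+ 2.
  rewrite leNgt; apply/negP => /hA [z [_ z1]]; apply/negP; rewrite -leNgt.
  rewrite ler_sqr ?nnegrE ?cabs_ge0 //.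
  apply: le_trans (cabsD _ _) _; apply: lerD => //.
  apply: le_trans (cabs_sum _ _ _) _; apply: ler_sum => j _.
  by rewrite cabsM z1 // mulr1.
have [v v1 bv] := polar b.
have /choice[E hE] : forall j, exists E : set R,
    [/\ measurable E, E `<=` `[0%R, 1%R[, lebesgue_measure E = (2 * h)%:E &
    forall t, E t -> exists2 s, `|s| <= h & a j * expi t = (cabs (a j))%:C%C * v * expi s].
  move=> j; have [w w1 aw] := polar (a j).
  have w0 : w != 0.
    by apply/eqP => h'; move: w1; rewrite h' cabs0 => /eqP; rewrite eq_sym oner_eq0.
  (* [v / w] is the position of the variable that turns the direction [w] of [a j] into [v]. *)
  have [|E [mE E1 eE hE]] := @circle_arc _ (v / w) h _ h01.
    by apply: (mulIf (oner_neq0 _)); rewrite -{1}w1 -cabsM divfK // v1 mulr1.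
  exists E; split=> // t /hE[s sh ->]; exists s => //.
  by rewrite {1}aw; field.
apply: (iter_int_indic_prod_ge (E := E)); first by lra.
- by move=> j; have [] := hE j.
- by move=> j; have [] := hE j.
- by move=> j; have [] := hE j.
move=> x sx xE /=; apply: le_trans (_ : (S * L) ^+ 2 <= _).
  by rewrite exprMn ler_wpM2r ?sqr_ge0.
rewrite ler_sqr ?nnegrE ?cabs_ge0 ?mulr_ge0 //.
have [s hs] : exists s : nat -> R, forall j, (j < l)%N ->
    `|s j| <= h /\ a j * nth 0 (map (@expi R) x) j = (cabs (a j))%:C%C * v * expi (s j).
  suff /choice[s hs] : forall j, exists sj : R, (j < l)%N ->
    `|sj| <= h /\ a j * nth 0 (map (@expi R) x) j = (cabs (a j))%:C%C * v * expi sj.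
    by exists s.
  move=> j; have [jl|_] := ltnP j l; last by exists 0.
  have [_ _ _ /(_ _ (xE j jl)) [s sh es]] := hE j.
  by exists s => _; rewrite (nth_map 0) ?sx.
have -> : b + \sum_(j < l) a j * nth 0 (map (@expi R) x) j =
    v * ((cabs b)%:C%C + \sum_(j < l) (cabs (a j))%:C%C * expi (s j)).
  rewrite mulrDr {1}bv [_ * v]mulrC mulr_sumr; congr (_ + _); apply: eq_bigr => j _.
  by have [_ ->] := hs j (ltn_ord j); ring.
rewrite cabsM v1 mul1r; apply: le_trans (Re_le_cabs _).
rewrite raddfD raddf_sum /= /S mulrDl mulr_suml; apply: lerD.
  by apply: ler_piMr; [exact: cabs_ge0 | have := sqr_ge0 (2 * pi * h); lra].
apply: ler_sum => j _; rewrite mul0r subr0 ler_wpM2l ?cabs_ge0 //.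
have [sj _] := hs j (ltn_ord j).
have := one_sub_cos_le (2 * pi * s j).
have : (2 * pi * s j) ^+ 2 <= (2 * pi * h) ^+ 2.
  rewrite -(real_normK (num_real (2 * pi * s j))) ler_sqr ?nnegrE ?mulr_ge0 ?pi_ge0 //.
  by rewrite normrM ger0_norm ?mulr_ge0 ?pi_ge0 // ler_wpM2l // mulr_ge0 ?pi_ge0.
lra.
Qed.

(** Take a point [w :: z] where the squared modulus is nearly [G]. In the first variable
    [bernstein_near_max] applies, and the same [z] serves every rotation [t] of [w]. *)
Lemma sup_sqr_ge_cons r c e d (m : nat) (h s A : R) :
  (forall n, n \in r -> (e n 0%N <= m)%N) -> (0 < m)%N -> 0 <= h ->
  m%:R * h <= 1 / 2 -> (2 * pi * (m%:R * h)) ^+ 2 / 2 < s -> s <= 1 ->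
  sup_sqr_ge d.+1 (mpol r c e d.+1) A ->
  exists2 w, cabs w = 1 & forall t, `|t| <= h ->
    sup_sqr_ge d (fun z => mpol r c e d.+1 (w * expi t :: z)) (A * (1 - s)).
Proof.
move=> em m0 h0 mh hs s1 hA.
pose V := [set cabs (mpol r c e d.+1 z) ^+ 2 | z in @torus R d.+1]; pose G := sup V.
have Vne : V !=set0.
  by exists (cabs (mpol r c e d.+1 (nseq d.+1 1)) ^+ 2); eexists; first exact: torus_nseq.
have Vub : has_ubound V.
  exists ((\sum_(n <- r) cabs (c n)) ^+ 2) => _ [z tz <-].
  rewrite ler_sqr ?nnegrE ?cabs_ge0 ?cabs_mpol_le //.
  by apply: sumr_ge0 => n _; exact: cabs_ge0.
have hG z : torus d.+1 z -> cabs (mpol r c e d.+1 z) ^+ 2 <= G.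
  by move=> tz; apply: ub_le_sup => //; exists z.
have AG : A <= G.
  rewrite leNgt; apply/negP => /hA[z tz]; apply/negP; rewrite -leNgt; exact: hG.
(* If [G <= 0], then [A * (1 - s) <= 0] and any point will do. *)
have [G0|G0] := leP G 0.
  exists 1; first exact: cabs1.
  move=> t th B BA; exists (nseq d 1); first exact: torus_nseq.
  apply: lt_le_trans BA _; apply: le_trans (sqr_ge0 _); nra.
set u := (2 * pi * (m%:R * h)) ^+ 2 / 2 in hs.
(* The deficit is doubled by [bernstein_near_max]; twice [(s - u) / 2] plus the loss [u] makes
   [s]. *)
have [|_ [z tz <-] hz] := @sup_gt R V (G - (s - u) / 2 * G) Vne.
  by rewrite -/G; nra.
case: z tz hz => [[]//|w z] tz hz; exists w; first exact: (tz.2 0%N).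
have tz' : torus d z.
  by split; [have [[]] := tz | move=> j jd; exact: (tz.2 j.+1)].
move=> t th B BA; exists z => //; apply: lt_le_trans BA _.
have [b hb] := @mpol_cons_poly r c e d m z em.
have mt : `|m%:R * t| <= m%:R * h by rewrite normrM ger0_norm // ler_wpM2l.
have := @bernstein_near_max R m b w t G m0 (le_trans mt mh) (tz.2 0%N isT).
rewrite -!hb; set q := cabs (mpol _ _ _ _ (_ * _ :: _)) ^+ 2.
move=> hq; apply: le_trans (_ : G * (1 - s) <= q); first by rewrite ler_wpM2r ?subr_ge0.
apply: le_trans (hq _); last first.
  by move=> y y1; rewrite -hb; apply: hG; apply: torus_cons.
have : (2 * pi * (m%:R * t)) ^+ 2 / 2 * G <= u * G.
  rewrite ler_wpM2r ?(ltW G0) // /u ler_pM2r //.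
  rewrite -(real_normK (num_real (2 * pi * (m%:R * t)))).
  rewrite ler_sqr ?nnegrE ?mulr_ge0 ?pi_ge0 //.
  by rewrite [`|2 * pi * _|]normrM [`|2 * pi|]ger0_norm ?mulr_ge0 ?pi_ge0 //
    ler_wpM2l // mulr_ge0 ?pi_ge0.
nra.
Qed.

(** Induction on [k]: each of the first variables gives an arc of length [2 * hh j] at the price of
    a factor [1 - s j], and the remaining [l] variables are affine. Later arcs may depend on earlier
    angles, since only the measures of the slices enter. *)
Lemma large_values_measure (k l : nat) r c e (m : nat -> nat) (hh s : nat -> R)
    (A h L : R) :
  (forall n j, n \in r -> (j < k)%N -> (e n j <= m j)%N) ->
  (forall n, n \in r -> (\sum_(j < l) e n (k + j) <= 1)%N) ->
  (forall j, (j < k)%N -> [/\ (0 < m j)%N, 0 <= hh j, (m j)%:R * hh j <= 1 / 2,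
     (2 * pi * ((m j)%:R * hh j)) ^+ 2 / 2 < s j & s j <= 1]) ->
  0 <= h <= 1 / 2 -> 0 <= L <= 1 - (2 * pi * h) ^+ 2 / 2 ->
  sup_sqr_ge (k + l) (mpol r c e (k + l)) A ->
  ((\prod_(j < k) (2 * hh j) * (2 * h) ^+ l)%:E <= iter_int (k + l) (fun x =>
     (\1_[set x | A * \prod_(j < k) (1 - s j) * L ^+ 2
                  <= cabs (mpol r c e (k + l) (map (@expi R) x)) ^+ 2]%R x)%:E))%E.
Proof.
move=> + + + h01 hL; elim: k r c e m hh s A => [|k IH] r c e m hh s A em el hyp hA.
  rewrite !big_ord0 mul1r mulr1.
  have [b [a ba]] := @mpol_affine r c e l el.
  have := @affine_large_values l b a A h L _ h01 hL.
  rewrite (_ : (fun z => _) = mpol r c e l); last by apply/funext => z; rewrite ba.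
  by under eq_set do rewrite -ba; apply.
have [m0 hh0 mh0 sh0 s01] := hyp 0%N isT.
have [w w1 hw] := sup_sqr_ge_cons (fun n nr => em n 0%N nr isT) m0 hh0 mh0 sh0 s01 hA.
have hh1 : 0 <= hh 0%N <= 1 / 2.
  have : 1 <= (m 0%N)%:R :> R by rewrite ler1n.
  by rewrite hh0; nra.
have [E [mE E1 eE hE]] := circle_arc w1 hh1.
rewrite !big_ord_recl -mulrA addSn; apply: (iter_int_cons_ge (E := E)) => //.
  rewrite mulr_ge0 ?exprn_ge0 ?prodr_ge0 //; last by have /andP[? _] := h01; lra.
  by move=> j _; have [|_ ? _ _ _] := hyp (lift ord0 j); rewrite ?mulr_ge0.
move=> t /hE[t' th' et].
apply: (le_trans (IH r (fun n => c n * expi t ^+ e n 0%N) (fun n j => e n j.+1)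
  (fun j => m j.+1) (fun j => hh j.+1) (fun j => s j.+1) (A * (1 - s 0%N)) _ _ _ _)).
- by move=> n j nr jk; exact: em.
- by move=> n nr; exact: el.
- by move=> j jk; exact: hyp.
- move=> B /(hw _ th')[z tz]; rewrite -et mpol_cons => hz.
  by exists z.
rewrite le_eqVlt; apply/orP; left; apply/eqP; congr iter_int; apply/funext => x.
rewrite !indicE; congr (_ %:R)%:E.
congr (nat_of_bool _).
apply/idP/idP; rewrite !inE /= mpol_cons !mulrA //.
Qed.

End large_values.

(** * Estimates for primes *)

Section prime_counting.

Definition primorial (n : nat) : nat := \prod_(p <- primes_upto n) p.

Lemma primes_uptoS n : primes_upto n.+1 =
  if prime n.+1 then rcons (primes_upto n) n.+1 else primes_upto n.
Proof.
rewrite /primes_upto -(addn1 n.+1) iotaD filter_cat /= add0n.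
by case: ifP => _; rewrite ?cats1 ?cats0.
Qed.

Lemma primorialS n : primorial n.+1 = (primorial n * (if prime n.+1 then n.+1 else 1))%N.
Proof.
rewrite /primorial primes_uptoS; case: ifP => _; last by rewrite muln1.
by rewrite -cats1 big_cat big_seq1.
Qed.

Lemma primepiS n : primepi n.+1 = (primepi n + prime n.+1)%N.
Proof. by rewrite /primepi primes_uptoS; case: ifP; rewrite ?size_rcons ?addn1 ?addn0. Qed.

Lemma mem_primes_upto n p : (p \in primes_upto n) = prime p && (p <= n)%N.
Proof. by rewrite mem_filter mem_iota. Qed.

Lemma primes_upto_uniq n : uniq (primes_upto n).
Proof. by rewrite filter_uniq ?iota_uniq. Qed.

(** * Chebyshev-type bounds for primes *)

Lemma bin_half_le (m : nat) : ('C(m.*2.+1, m) <= 4 ^ m)%N.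
Proof.
have h : ('C(m.*2.+1, m) + 'C(m.*2.+1, m.+1) <= 2 ^ m.*2.+1)%N.
  rewrite -[2%N]/(1 + 1)%N expnDn.
  rewrite (eq_bigr (fun i : 'I_m.*2.+2 => 'C(m.*2.+1, i))); last first.
    by move=> i _; rewrite !exp1n !muln1.
  have i1 : (m < m.*2.+2)%N by lia.
  have i2 : (m.+1 < m.*2.+2)%N by lia.
  rewrite (bigD1 (Ordinal i1)) //= (bigD1 (Ordinal i2)) /=; last first.
    by apply/eqP => /(congr1 val) /=; lia.
  by rewrite addnA leq_addr.
have e : 'C(m.*2.+1, m.+1) = 'C(m.*2.+1, m).
  rewrite -(@bin_sub m.*2.+1 m.+1); last by lia.
  by congr binomial; lia.
have -> : (4 ^ m = 2 ^ m.*2)%N by rewrite -mul2n expnM.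
by move: h; rewrite e expnS; lia.
Qed.

Lemma prime_ndvd_fact (n p : nat) : prime p -> (n < p)%N -> ~~ (p %| n`!)%N.
Proof.
move=> pp; elim: n => [|n IH] np; first by rewrite fact0 Euclid_dvd1.
by rewrite factS Euclid_dvdM // negb_or gtnNdvd //= IH // ltnW.
Qed.

(** Such a [p] divides [(2m+1)!] but neither [m!] nor [(m+1)!]. *)
Lemma prime_dvd_bin_half (m p : nat) : prime p -> (m.+1 < p <= m.*2.+1)%N ->
  (p %| 'C(m.*2.+1, m))%N.
Proof.
move=> pp /andP[mp pm].
have h : ('C(m.*2.+1, m) * (m`! * (m.*2.+1 - m)`!) = m.*2.+1`!)%N.
  by apply: bin_fact; lia.
have : (p %| m.*2.+1`!)%N by rewrite dvdn_fact // prime_gt0.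
rewrite -h !Euclid_dvdM // => /orP[//|/orP[]]; apply: contraTT => _.
  by apply: prime_ndvd_fact => //; lia.
by apply: prime_ndvd_fact => //; lia.
Qed.

Lemma prod_primes_dvd (s : seq nat) (D : nat) : uniq s ->
  (forall p, p \in s -> prime p /\ (p %| D)%N) -> (\prod_(p <- s) p %| D)%N.
Proof.
elim: s => [|p s IH] /=; first by rewrite big_nil dvd1n.
move=> /andP[ps us] h; have [pp pD] := h p (mem_head _ _).
rewrite big_cons Gauss_dvd ?pD ?IH //.
  by move=> q qs; apply: h; rewrite in_cons qs orbT.
rewrite coprime_sym big_seq; apply: (big_ind (fun x => coprime x p)).
- exact: coprime1n.
- by move=> x y; rewrite coprimeMl => -> ->.
move=> q qs; have [qp _] : prime q /\ (q %| D)%N by apply: h; rewrite in_cons qs orbT.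
rewrite prime_coprime // dvdn_prime2 //.
by apply: contra ps => /eqP <-.
Qed.

(** Strong induction after Erdős: an even number above 2 adds no prime, and for [n = 2m + 1] the
    primes in [[m+2, 2m+1]] have a product dividing a binomial coefficient of size at most [4^m]. *)
Lemma primorial_le (n : nat) : (primorial n <= 4 ^ n)%N.
Proof.
elim/ltn_ind: n => n IH.
have [nodd|neven] := boolP (odd n); last first.
  case: n neven IH => [|n] neven IH; first by rewrite /primorial big_nil.
  rewrite primorialS; case: ifP => [pn|_]; last first.
    by rewrite muln1 (leq_trans (IH n _)) // leq_pexp2l.
  have -> : n = 1%N.
    by have := prime_oddPn pn neven; lia.
  by rewrite primorialS /primorial big_nil.
have [m nE] : exists m, n = m.*2.+1 by exists n./2; lia.
case: m nE => [->|m nE]; first by rewrite /primorial big_nil.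
move: m.+1 nE (isT : (0 < m.+1)%N) => {}m nE m0.
have -> : primorial n = (primorial m.+1 * \prod_(p <- seq.filter prime (iota m.+2 m)) p)%N.
  rewrite /primorial /primes_upto nE.
  have -> : iota 0 m.*2.+2 = iota 0 m.+2 ++ iota m.+2 m.
    by rewrite -[in RHS](add0n m.+2) -iotaD; congr iota; lia.
  by rewrite filter_cat big_cat.
have -> : (4 ^ n = 4 ^ m.+1 * 4 ^ m)%N by rewrite -expnD; congr expn; lia.
apply: leq_mul; first by apply: IH; lia.
apply: leq_trans (bin_half_le m); apply: dvdn_leq; first by rewrite bin_gt0; lia.
apply: prod_primes_dvd => [|p]; first by rewrite filter_uniq ?iota_uniq.
rewrite mem_filter mem_iota => /andP[pp pm]; split=> //.
by apply: prime_dvd_bin_half => //; lia.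
Qed.

(** Equality holds at 9, which has four primes below it. Afterwards only odd numbers can be prime,
    and [n + odd n] grows by 2 on reaching each odd number. *)
Lemma primepi_le_half (n : nat) : (9 <= n)%N -> ((primepi n).*2.+2 <= n + odd n)%N.
Proof.
elim: n => // n IH; rewrite leq_eqVlt => /orP[/eqP <-|n9]; first by vm_compute.
have {IH} := IH n9; rewrite primepiS.
have [pn|_] := boolP (prime n.+1); last by rewrite /=; lia.
have : odd n.+1 by have [|] := even_prime pn; lia.
rewrite /=; lia.
Qed.

Lemma primepi_lt (n : nat) : (0 < n)%N -> (primepi n < n)%N.
Proof.
elim: n => // -[_ _|n IH _]; first by vm_compute.
by rewrite primepiS; have := IH isT; case: (prime _); lia.
Qed.

Lemma floor_root (k n : nat) : (0 < k)%N -> exists x, (x ^ k <= n < x.+1 ^ k)%N.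
Proof.
move=> k0; elim: n => [|n [x /andP[xn nx]]].
  by exists 0%N; rewrite exp0n // exp1n.
have [h|h] := ltnP n.+1 (x.+1 ^ k).
  by exists x; rewrite h andbT leqW.
exists x.+1; rewrite h /=; apply: leq_ltn_trans nx _.
by rewrite ltn_exp2r.
Qed.

(** * Numerical bounds for e and products over small primes *)

Variable R : realType.
Local Notation e1 := (expR 1 : R).

(** The first five terms of the exponential series add up to [65 / 24]. *)
Lemma expR1_ge : 27 / 10 <= expR 1 :> R.
Proof.
have nd : nondecreasing_seq (series (exp_coeff (1 : R))).
  by apply: nondecreasing_series => n _ _; rewrite /exp_coeff /= expr1n divr_ge0.
apply: le_trans (nondecreasing_cvgn_le nd (is_cvg_series_exp_coeff 1) 5).
rewrite /series /= /exp_coeff /= !big_nat_recr //= big_nil !expr1n.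
rewrite (_ : 0`! = 1)%N // (_ : 1`! = 1)%N // (_ : 2`! = 2)%N // (_ : 3`! = 6)%N //.
rewrite (_ : 4`! = 24)%N //; lra.
Qed.

(** [expR (1 / 2) <= 2], because [expR (- (1 / 2)) >= 1 / 2]. *)
Lemma expR1_le : expR 1 <= 4 :> R.
Proof.
have h := expR_ge1Dx (- (1 / 2) : R).
have := expRxMexpNx_1 (1 / 2 : R); have := expR_gt0 (1 / 2 : R).
have -> : expR 1 = expR (1 / 2) * expR (1 / 2) :> R by rewrite -expRD; congr expR; lra.
nra.
Qed.

Lemma succ_pow_le (k : nat) : (k.+1%:R : R) ^+ k <= e1 * k%:R ^+ k.
Proof.
case: k => [|k]; first by rewrite !expr0 mulr1; have := expR1_ge; lra.
have k0 : 0 < k.+1%:R :> R by rewrite ltr0n.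
have -> : k.+2%:R = (1 + k.+1%:R^-1) * k.+1%:R :> R.
  by rewrite mulrDl mul1r mulVf ?gt_eqF // -[k.+2%:R]natr1.
rewrite exprMn ler_wpM2r ?exprn_ge0 //.
have -> : e1 = expR (k.+1%:R^-1) ^+ k.+1 by rewrite -expRM_natl divff ?gt_eqF.
by rewrite lerXn2r ?nnegrE ?expR_ge0 ?addr_ge0 ?invr_ge0 ?expR_ge1Dx // ltW.
Qed.

(** When [n + 1] is prime, the left side grows by at most [e (k + 1)] and the right side by
    [(e / 2) (n + 1)]; [primepi_le_half] compares the two once [n >= 9]. *)
Lemma primepi_pow_le (n : nat) :
  (primepi n)%:R ^+ primepi n <= (e1 / 2) ^+ primepi n * (primorial n)%:R :> R.
Proof.
have e27 : 27 / 10 <= e1 := expR1_ge.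
have small n' : (n' <= 9)%N -> (primepi n')%:R ^+ primepi n' <=
    (e1 / 2) ^+ primepi n' * (primorial n')%:R :> R.
  move=> n9.
  (* The claim in integers, with [4 / 3 <= e / 2] in place of [e / 2], checked by computation. *)
  have h : ((3 * primepi n') ^ primepi n' <= 4 ^ primepi n' * primorial n')%N.
    have : all (fun i => (3 * primepi i) ^ primepi i <= 4 ^ primepi i * primorial i)%N
      (iota 0 10).
      by rewrite /primorial unlock; vm_compute.
    by move/allP; apply; rewrite mem_iota.
  have {}h : ((3 * primepi n')%:R : R) ^+ primepi n' <= 4 ^+ primepi n' * (primorial n')%:R.
    by rewrite -natrX -[4]/(4%:R) -natrX -natrM ler_nat.
  have h2 : (4 / 3) ^+ primepi n' <= (e1 / 2) ^+ primepi n'.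
    by apply: lerXn2r; rewrite ?nnegrE; lra.
  apply: le_trans (ler_wpM2r (ler0n _ _) h2).
  rewrite exprMn exprVn mulrAC ler_pdivlMr ?exprn_gt0 //.
  by rewrite -exprMn mulrC -[3]/(3%:R) -natrM.
elim: n => [|n IH]; first exact: small.
have [n9|n9] := leqP n 8; first exact: small.
rewrite primepiS primorialS; case: ifP => [pn|_]; last by rewrite addn0 muln1.
rewrite addn1; set k := primepi n in IH *.
have kn : 2 * k.+1%:R <= n.+1%:R :> R.
  have := primepi_le_half n9; rewrite -/k => h.
  by rewrite -natrM ler_nat; move: h; case: (odd n); lia.
rewrite exprS natrM [X in _ <= X * _]exprS.
apply: le_trans (_ : k.+1%:R * (e1 * ((e1 / 2) ^+ k * (primorial n)%:R)) <= _).
  rewrite ler_wpM2l //; apply: le_trans (succ_pow_le k) _.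
  by rewrite ler_wpM2l // ; lra.
have A0 : 0 <= (e1 / 2) ^+ k * (primorial n)%:R by rewrite mulr_ge0 // exprn_ge0 //; lra.
have -> : e1 / 2 * (e1 / 2) ^+ k * ((primorial n)%:R * n.+1%:R) =
   e1 / 2 * n.+1%:R * ((e1 / 2) ^+ k * (primorial n)%:R) by ring.
rewrite mulrA ler_wpM2r //; nra.
Qed.

(** The constants come from [e >= 27 / 10]: then [91 / 50 <= e^2 / 4] and
    [243 / 10 = 9 * 27 / 10 <= 9 e]. From 5 on, consecutive left sides have ratio at most
    [91 / 50]. *)
Lemma quadratic_le_pow (y : nat) :
  (4 * y%:R - 1) ^+ 2 <= 243 / 10 * (91 / 50) ^+ y :> R.
Proof.
do 5![case: y => [|y]; first by rewrite ?expr0 ?exprS ?expr0; lra].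
elim: y => [|y IH]; first by rewrite !exprS expr0; lra.
rewrite [in leRHS]exprS; set q := (91 / 50) ^+ y.+1.+4 in IH *.
have : 5 <= y.+1.+4%:R :> R by rewrite ler_nat.
rewrite -[y.+1.+4.+1%:R]natr1; set x := y.+1.+4%:R in IH * => x5.
have : (4 * (x + 1) - 1) ^+ 2 <= 91 / 50 * (4 * x - 1) ^+ 2 by nra.
lra.
Qed.

(** Let [m] be the logarithm. If [p > y], then [p^4 > N], so [m <= 3] and the factor is at most
    [e / 4 <= 1]. If [p <= y], then [2^m <= N < (y+1)^4 <= 2^(4y)], so [m <= 4 y - 1] and
    [quadratic_le_pow] applies. *)
Lemma trunc_log_factor_le (N y p : nat) : (N < y.+1 ^ 4)%N -> (0 < y)%N -> prime p ->
  e1 / 36 * (trunc_log p N)%:R ^+ 2 <=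
  if (p <= y)%N then (e1 ^+ 2 / 4) ^+ y.+1 else 1.
Proof.
move=> Ny y0 pp; have e27 : 27 / 10 <= e1 := expR1_ge; have e4 : e1 <= 4 := expR1_le.
have p1 := prime_gt1 pp.
set m := trunc_log p N.
have [N0|N0] := posnP N.
  rewrite /m N0 trunc_log0 expr0n mulr0; case: ifP => // _; rewrite exprn_ge0 //; nra.
have mN : (p ^ m <= N)%N by exact: trunc_logP.
case: ifP => [_|/negbT]; last first.
  rewrite -ltnNge => yp; have m3 : (m <= 3)%N.
    rewrite leqNgt; apply/negP => m4.
    have : (y.+1 ^ 4 <= p ^ m)%N.
      by apply: leq_trans (_ : p ^ 4 <= _)%N; rewrite ?leq_exp2r ?leq_pexp2l ?(ltnW p1).
    lia.
  have : (m%:R : R) <= 3 by rewrite ler_nat.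
  have : 0 <= (m%:R : R) by []. nra.
have m4y : (m < 4 * y)%N.
  rewrite -(@ltn_exp2l 2) //; apply: leq_ltn_trans (_ : p ^ m < _)%N.
    by case: (m) => [//|i]; rewrite leq_exp2r.
  apply: leq_ltn_trans mN _; apply: leq_trans Ny _.
  by rewrite mulnC expnM leq_exp2r // ltn_expl.
have {}m4y : (m%:R : R) <= 4 * y%:R - 1.
  by rewrite lerBrDr natr1 -natrM ler_nat.
have hq := quadratic_le_pow y.
have hQ : (91 / 50) ^+ y <= (e1 ^+ 2 / 4) ^+ y.
  by apply: lerXn2r; rewrite ?nnegrE; nra.
rewrite [in leRHS]exprS; set Q := (e1 ^+ 2 / 4) ^+ y in hQ *.
have hm : m%:R ^+ 2 <= 243 / 10 * Q.
  apply: le_trans (_ : (4 * y%:R - 1) ^+ 2 <= _); last lra.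
  by rewrite ler_sqr ?nnegrE //; apply: le_trans m4y.
have Q0 : 0 <= Q by rewrite /Q exprn_ge0 //; nra.
apply: le_trans (_ : e1 / 36 * (243 / 10 * Q) <= _); first by rewrite ler_wpM2l //; lra.
have : 0 <= e1 * Q by rewrite mulr_ge0 //; lra.
nra.
Qed.

(** Each factor is split as [k (2 / e)] times [e m^2 / 36]. The first parts multiply to at most the
    primorial, hence to at most [4^X], the second to at most [Q^X], and [4 Q = e^2]. *)
Lemma prod_small_primes_le (N X : nat) : (0 < N)%N -> (X ^ 2 <= N < X.+1 ^ 2)%N ->
  \prod_(p <- primes_upto X) ((primepi X)%:R * (trunc_log p N)%:R ^+ 2 / 18)
    <= e1 ^+ X.*2.
Proof.
move=> N0 /andP[XN NX]; have e27 : 27 / 10 <= e1 := expR1_ge.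
have [y /andP[yN Ny]] := floor_root N (isT : (0 < 4)%N).
have y0 : (0 < y)%N by case: y yN Ny => // _; rewrite exp1n; lia.
have yX : (y ^ 2 <= X)%N.
  rewrite -ltnS -(@ltn_exp2r _ _ 2) // -expnM; exact: leq_ltn_trans yN NX.
set Q := e1 ^+ 2 / 4; have Q1 : 1 <= Q by rewrite /Q; nra.
set k := primepi X.
have hprod : \prod_(p <- primes_upto X) (e1 / 36 * (trunc_log p N)%:R ^+ 2) <= Q ^+ X.
  apply: le_trans (_ : \prod_(p <- primes_upto X)
      (if (p <= y)%N then Q ^+ y.+1 else 1) <= _).
    rewrite !big_seq; apply: ler_prod => p; rewrite mem_primes_upto => /andP[pp _].
    rewrite trunc_log_factor_le // andbT mulr_ge0 ?exprn_ge0 //; lra.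
  rewrite -big_mkcond /= -big_filter big_const_seq count_predT iter_mulr_1 -exprM.
  apply: ler_weXn2l => //; apply: leq_trans yX.
  (* At most [y - 1] primes are [<= y], each contributing [Q^(y+1)], and
     [(y + 1)(y - 1) <= y^2 <= X]. *)
  apply: leq_trans (_ : y.+1 * y.-1 <= _)%N; last by nia.
  rewrite leq_mul2l /=; apply: leq_trans (_ : primepi y <= _)%N; last first.
    by have := primepi_lt y0; lia.
  apply: uniq_leq_size; first by rewrite filter_uniq ?primes_upto_uniq.
  by move=> p; rewrite mem_filter !mem_primes_upto => /andP[-> /andP[-> _]].
have e0 : 0 < e1 / 2 by lra.
have hk := primepi_pow_le X; rewrite -/k in hk.
have hpr : (primorial X)%:R <= 4 ^+ X :> R.
  by rewrite -[4]/(4%:R) -natrX ler_nat primorial_le.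
have -> : \prod_(p <- primes_upto X) (k%:R * (trunc_log p N)%:R ^+ 2 / 18) =
   k%:R ^+ k * (e1 / 2) ^- k *
     \prod_(p <- primes_upto X) (e1 / 36 * (trunc_log p N)%:R ^+ 2).
  rewrite -exprVn -exprMn /k /primepi -(count_predT (primes_upto X)) -iter_mulr_1.
  rewrite -big_const_seq -big_split /=; apply: eq_bigr => p _.
  by field; lra.
apply: le_trans (_ : 4 ^+ X * Q ^+ X <= _); last first.
  rewrite -exprMn /Q mulrCA divff // mulr1 -exprM mul2n //.
apply: ler_pM => //.
  by apply: prodr_ge0 => p _; rewrite mulr_ge0 ?exprn_ge0 //; lra.
rewrite ler_pdivrMr ?exprn_gt0 // mulrC; apply: le_trans hk _.
by rewrite ler_wpM2l // exprn_ge0 // ltW.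
Qed.

End prime_counting.

(** * Dirichlet polynomials *)

Section dirichlet.
Local Open Scope classical_set_scope.
Variable R : realType.

Lemma primes_upto_cat (X N : nat) : (X <= N)%N ->
  primes_upto N = primes_upto X ++ seq.filter prime (iota X.+1 (N - X)).
Proof.
by move=> XN; rewrite /primes_upto -filter_cat -[X.+1 in RHS]add0n -iotaD addSn subnKC.
Qed.

Lemma nth_primes_upto_gt (X N j : nat) : (X <= N)%N -> (primepi X <= j < primepi N)%N ->
  (X < nth 0%N (primes_upto N) j)%N.
Proof.
move=> XN /andP[Xj jN].
rewrite (primes_upto_cat XN) nth_cat -/(primepi X) [(j < primepi X)%N]ltnNge Xj /=.
have : nth 0%N (seq.filter prime (iota X.+1 (N - X))) (j - size (primes_upto X))
    \in seq.filter prime (iota X.+1 (N - X)).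
  apply: mem_nth; rewrite ltn_subLR //; apply: leq_trans jN _.
  by rewrite /primepi (primes_upto_cat XN) size_cat.
by rewrite mem_filter mem_iota => /andP[_ /andP[]].
Qed.

Lemma prod_nth_primes_dvd (N n k l : nat) : (k + l <= primepi N)%N -> (0 < n)%N ->
  (\prod_(j < l) nth 0%N (primes_upto N) (k + j) ^
     logn (nth 0%N (primes_upto N) (k + j)) n <= n)%N.
Proof.
move=> kl n0; apply: dvdn_leq => //.
have hp j : (j < l)%N -> prime (nth 0%N (primes_upto N) (k + j)).
  move=> jl; have : nth 0%N (primes_upto N) (k + j) \in primes_upto N.
    by apply: mem_nth; rewrite -/(primepi N); lia.
  by rewrite mem_primes_upto => /andP[].
elim: l kl hp => [|l IH] kl hp; first by rewrite big_ord0 dvd1n.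
rewrite big_ord_recr /= Gauss_dvd ?IH ?pfactor_dvdnn //; first lia.
  by move=> j jl; apply: hp; lia.
rewrite coprime_sym; apply: (big_ind (fun x => coprime _ x)) => [|x y|j _].
- exact: coprimen1.
- by rewrite coprimeMr => -> ->.
apply/coprimeXl/coprimeXr; have jl := ltn_ord j;
have [pl pj] : prime (nth 0%N (primes_upto N) (k + l)) /\
    prime (nth 0%N (primes_upto N) (k + j)) by split; apply: hp; lia.
rewrite prime_coprime // dvdn_prime2 // nth_uniq ?primes_upto_uniq //;
  rewrite -?/(primepi N); lia.
Qed.

(** Two prime factors above [X], counted with multiplicity, would force [n >= (X+1)^2 > N]. *)
Lemma sum_logn_large_le1 (N X n : nat) : (X <= N)%N -> (N < X.+1 ^ 2)%N -> (0 < n <= N)%N ->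
  (\sum_(j < primepi N - primepi X)
     logn (nth 0%N (primes_upto N) (primepi X + j)) n <= 1)%N.
Proof.
move=> XN NX /andP[n0 nN]; set l := (_ - _)%N.
have kl : (primepi X + l <= primepi N)%N.
  by rewrite /l subnKC // /primepi (primes_upto_cat XN) size_cat leq_addr.
rewrite leqNgt; apply/negP => h2.
have := prod_nth_primes_dvd kl n0; rewrite leqNgt => /negP; apply.
apply: leq_ltn_trans nN _; apply: leq_trans NX _.
apply: leq_trans (_ :
    X.+1 ^ (\sum_(j < l) logn (nth 0%N (primes_upto N) (primepi X + j)) n) <= _)%N.
  by rewrite leq_pexp2l.
rewrite (big_morph (expn X.+1) (expnD X.+1) (expn0 X.+1)); apply: leq_prod => j _.
have hj : (X < nth 0%N (primes_upto N) (primepi X + j))%N.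
  by apply: nth_primes_upto_gt => //; have := ltn_ord j; rewrite /l; lia.
by case: (logn _ n) => [//|i]; rewrite leq_exp2r.
Qed.

Lemma Dpoly_mpol (N : nat) (a : nat -> R[i]) (z : seq R[i]) :
  Dpoly N a z = mpol (index_iota 1 N.+1) a
    (fun n j => logn (nth 0%N (primes_upto N) j) n) (primepi N) z.
Proof. by []. Qed.

Lemma sup_norm_sqr_ge (N : nat) (a : nat -> R[i]) :
  0 <= sup_norm N a /\ sup_sqr_ge (primepi N) (Dpoly N a) (sup_norm N a ^+ 2).
Proof.
rewrite /sup_norm; set V := [set _ | _ in _]; set M := sup V.
have Vne : V !=set0.
  by exists (cabs (Dpoly N a (nseq (primepi N) 1))); eexists; first exact: torus_nseq.
have Vub : has_ubound V.
  exists (\sum_(n <- index_iota 1 N.+1) cabs (a n)) => _ [z tz <-].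
  by rewrite Dpoly_mpol cabs_mpol_le.
have M0 : 0 <= M.
  apply: le_trans (cabs_ge0 (Dpoly N a (nseq (primepi N) 1))) _.
  by apply: ub_le_sup => //; eexists; first exact: torus_nseq.
split=> // B BM; have [B0|B0] := ltP B 0.
  by exists (nseq (primepi N) 1); [exact: torus_nseq | apply: lt_le_trans (sqr_ge0 _)].
have [|_ [z tz <-] hz] := @sup_gt R V (Num.sqrt B) Vne.
  by rewrite -/M -(ger0_norm M0) -sqrtr_sqr ltr_sqrt // (le_lt_trans B0).
exists z => //; rewrite -(sqr_sqrtr B0) ltr_sqr ?nnegrE ?cabs_ge0 ?sqrtr_ge0 //.
Qed.

(** The comparison is confined to lists of length [d] because membership in [torus] fixes the
    length. *)
Lemma iter_int_le (d : nat) (f g : seq R -> \bar R) :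
  (forall x, 0 <= f x)%E -> (forall x, size x = d -> f x <= g x)%E ->
  (iter_int d f <= iter_int d g)%E.
Proof.
elim: d f g => [|d IH] f g f0 fg /=; first exact: fg.
apply: ge0_le_integral_nomeas => t _; first exact: iter_int_ge0.
by apply: IH => // x sx; apply: fg; rewrite /= sx.
Qed.

Lemma bernoulli_ge (n : nat) (x : R) : 0 <= x <= 1 -> 1 - n%:R * x <= (1 - x) ^+ n.
Proof.
move=> /andP[x0 x1]; elim: n => [|n IH]; first by rewrite mul0r subr0 expr0.
rewrite exprS -natr1; apply: le_trans (_ : (1 - x) * (1 - n%:R * x) <= _).
  have : 0 <= n%:R * x ^+ 2 by rewrite mulr_ge0 ?sqr_ge0. nra.
by rewrite ler_wpM2l // subr_ge0.
Qed.

End dirichlet.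

(** * Choice of the arcs and the final bound *)

Unset Implicit Arguments. Set Strict Implicit. Set Printing Implicit Defensive.

Theorem theorem3 (R : realType) (N : nat) (a : nat -> R[i]) (lambda : R) :
  (2 <= N)%N -> 0 < lambda -> lambda < 1 ->
  ((((1 - lambda) / pi ^+ 2) ^+ primepi N * expR (- Num.sqrt (N%:R)))%:E
     <= haar_torus (primepi N) (Xlambda N a lambda))%E.
Proof.
move=> N2 l0 l1; set mu := 1 - lambda.
have mu0 : 0 < mu by rewrite /mu; lra.
have mu1 : mu < 1 by rewrite /mu; lra.
have p3 := pi_ge3 R.
have [X /andP[XN NX]] := @floor_root 2 N isT.
have leXN : (X <= N)%N by nia.
set k := primepi X; set l := (primepi N - k)%N.
have kl : (k + l)%N = primepi N.
  by rewrite /l subnKC // /k /primepi (primes_upto_cat leXN) size_cat leq_addr.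
pose p j := nth 0%N (primes_upto N) j.
have pX j : (j < k)%N -> p j = nth 0%N (primes_upto X) j.
  by move=> jk; rewrite /p (primes_upto_cat leXN) nth_cat -/(primepi X) jk.
have pP j : (j < k)%N -> prime (p j) /\ (p j <= X)%N.
  move=> jk; have : p j \in primes_upto X by rewrite pX // mem_nth.
  by rewrite mem_primes_upto => /andP[].
pose m j := trunc_log (p j) N.
have m0 j : (j < k)%N -> (0 < m j)%N.
  move=> /pP[pp pjX]; rewrite /m trunc_log_gt0 prime_gt1 //=.
  by have := prime_gt1 pp; nia.
(* The 18 comes from [2 pi^2 >= 18]: with this [q], the Bernstein loss in variable [j] is
   [18 h mu / k <= mu^2 / k], below the allowance [mu / k]. *)
pose q j : R := Num.sqrt (18 / (k%:R * (m j)%:R ^+ 2)).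
have q0 j : 0 <= q j by exact: sqrtr_ge0.
have q2 j : q j ^+ 2 = 18 / (k%:R * (m j)%:R ^+ 2).
  by rewrite sqr_sqrtr // divr_ge0 // mulr_ge0 // exprn_ge0.
(* Half-lengths: the arcs measure [mu / pi^2 * q j] for the first [k] variables and [mu / pi^2] for
   the others. *)
pose hh j : R := mu / (2 * pi ^+ 2) * q j.
pose h : R := mu / (2 * pi ^+ 2).
have pi9 : 9 <= pi ^+ 2 :> R by nra.
have h0 : 0 <= h by rewrite divr_ge0 ?mulr_ge0 ?exprn_ge0 ?pi_ge0 // ltW.
have hE : h * (2 * pi ^+ 2) = mu by rewrite /h divfK // gt_eqF //; lra.
have hmu : 18 * h <= mu by rewrite -hE; nra.
pose L : R := 1 - (2 * pi * h) ^+ 2 / 2.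
have L1 : 1 - mu / 18 <= L.
  rewrite /L; have -> : (2 * pi * h) ^+ 2 / 2 = h * (h * (2 * pi ^+ 2)) by field.
  by rewrite hE; nra.
have [M0 hM] := sup_norm_sqr_ge N a; set M := sup_norm N a in M0 hM.
have hyp j : (j < k)%N -> [/\ (0 < m j)%N, 0 <= hh j, (m j)%:R * hh j <= 1 / 2,
     (2 * pi * ((m j)%:R * hh j)) ^+ 2 / 2 < mu / k%:R & mu / k%:R <= 1].
  move=> jk; have k0 : 1 <= k%:R :> R by rewrite ler1n; exact: leq_ltn_trans jk.
  have mj := m0 _ jk; have mj0 : 0 < (m j)%:R :> R by rewrite ltr0n.
  pose y := (m j)%:R * q j.
  have y0 : 0 <= y by rewrite mulr_ge0.
  have y2 : y ^+ 2 = 18 / k%:R.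
    by rewrite exprMn q2; field; rewrite !gt_eqF //; lra.
  have y2' : y ^+ 2 <= 18 by rewrite y2 ler_pdivrMr; nra.
  have mh : (m j)%:R * hh j = h * y by rewrite /hh /y /h; ring.
  split=> //.
  - by rewrite /hh mulr_ge0.
  - rewrite mh; have : y <= 9 by nra. nra.
  - rewrite mh.
    have -> : (2 * pi * (h * y)) ^+ 2 / 2 = h * (h * (2 * pi ^+ 2)) * y ^+ 2 by field.
    rewrite hE y2; have -> : h * mu * (18 / k%:R) = (h * 18 * mu) / k%:R by ring.
    rewrite ltr_pM2r ?invr_gt0; last lra.
    nra.
  - by rewrite ler_pdivrMr; lra.
have h01 : 0 <= h <= 1 / 2 by lra.
have hL : 0 <= L <= 1 - (2 * pi * h) ^+ 2 / 2 by rewrite -/L lexx andbT; lra.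
have hdeg n j : n \in index_iota 1 N.+1 -> (j < k)%N -> (logn (p j) n <= m j)%N.
  rewrite mem_index_iota => /andP[n1 nN] jk; have [pp _] := pP _ jk.
  rewrite /m trunc_log_max ?prime_gt1 //.
  apply: leq_trans (_ : n <= _)%N; last by rewrite -ltnS.
  by apply: dvdn_leq => //; exact: pfactor_dvdnn.
have hlin n : n \in index_iota 1 N.+1 -> (\sum_(j < l) logn (p (k + j)%N) n <= 1)%N.
  by rewrite mem_index_iota => n1N; apply: sum_logn_large_le1.
have hsup : sup_sqr_ge (k + l)
    (mpol (index_iota 1 N.+1) a (fun n j => logn (p j) n) (k + l))
    (M ^+ 2) by rewrite kl.
have H := large_values_measure hdeg hlin hyp h01 hL hsup.
rewrite kl in H; apply: le_trans (le_trans H _).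
- rewrite lee_fin.
  have two_hh j : 2 * hh j = mu / pi ^+ 2 * q j.
    by rewrite /hh; field; rewrite gt_eqF //; lra.
  have two_h : 2 * h = mu / pi ^+ 2 by rewrite /h; field; rewrite gt_eqF //; lra.
  under eq_bigr do rewrite two_hh.
  rewrite two_h big_split /= prodr_const card_ord mulrAC -exprD kl.
  apply: ler_wpM2l.
    by apply: exprn_ge0; apply: divr_ge0; [exact: ltW | exact: sqr_ge0].
  have N0 : (0 < N)%N := ltnW N2.
  have hQ := @prod_small_primes_le R N X N0; rewrite XN NX in hQ.
  have {}hQ : \prod_(j < k) (k%:R * (m j)%:R ^+ 2 / 18) <= expR 1 ^+ X.*2 :> R.
    apply: le_trans (hQ isT); rewrite (big_nth 0%N) big_mkord le_eqVlt.
    by apply/orP; left; apply/eqP; apply: eq_bigr => j _; rewrite /m pX.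
  have sq2 : (\prod_(j < k) q j) ^+ 2 = (\prod_(j < k) (k%:R * (m j)%:R ^+ 2 / 18))^-1.
    rewrite -prodrXl -prodfV; apply: eq_bigr => j _.
    by rewrite q2 invf_div.
  have P0 : 0 < \prod_(j < k) (k%:R * (m j)%:R ^+ 2 / 18) :> R.
    apply: prodr_gt0 => j _; have jk := ltn_ord j; have mj := m0 _ jk.
    by rewrite divr_gt0 // mulr_gt0 ?exprn_gt0 ?ltr0n //; exact: leq_ltn_trans jk.
  (* After squaring and inverting, this is the bound [e^(2X)] for the product over small primes. *)
  have : expR (- X%:R) <= \prod_(j < k) q j.
    rewrite -ler_sqr ?nnegrE ?expR_ge0 ?prodr_ge0 // sq2.
    rewrite expRN exprVn lef_pV2 ?posrE ?exprn_gt0 ?expR_gt0 //.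
    by apply: le_trans hQ _; rewrite -[X%:R]mulr1 expRM_natl -exprM muln2.
  apply: le_trans; rewrite ler_expR lerN2.
  by rewrite -[leLHS]ger0_norm // -sqrtr_sqr ler_wsqrtr // -natrX ler_nat.
rewrite /haar_torus; apply: iter_int_le => x; first by rewrite lee_fin.
move=> sx; rewrite lee_fin !indicE ler_nat.
case: (boolP (x \in _)) => //; rewrite inE /= => hx.
rewrite mem_set //; split.
  split; first by rewrite size_map.
  by move=> j jd; rewrite (nth_map 0) ?sx // cabs_expi.
rewrite -/M -ler_sqr ?nnegrE ?cabs_ge0 ?mulr_ge0 ?(ltW l0) //; apply: le_trans hx.
rewrite prodr_const card_ord exprMn mulrC -mulrA ler_wpM2l ?sqr_ge0 // expr2.
(* The square [lambda^2] is shared out: one factor is covered by [(1 - mu / k)^k >= 1 - mu], the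
   other by [L^2 >= (1 - mu / 18)^2]. *)
apply: ler_pM; rewrite ?(ltW l0) //; last by rewrite /mu in L1 mu0 mu1; nra.
have [k0|k0] := posnP k; first by rewrite k0 expr0 ltW.
have kR : 1 <= k%:R :> R by rewrite ler1n.
have := @bernoulli_ge R k (mu / k%:R).
rewrite [k%:R * _]mulrC divfK ?gt_eqF //; last lra.
rewrite /mu opprB addrCA subrr addr0 -/mu; apply.
by rewrite divr_ge0 ?(ltW mu0) //=; have [] := hyp 0%N k0.
Qed.
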